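(* For every even integer $n\ge 2$, $ASM^{\circ}_{n,1}$ is in bijection with the set of quarter-turn symmetric alternating sign matrices of size $2n\times 2n$.
   Context: An alternating sign matrix is a square matrix with entries in $\{0,1,-1\}$ such that each row and each column sums to $1$ and the nonzero entries alternate in sign along each row and each column. It is quarter-turn symmetric if it is invariant under rotation by $90$ degrees. For $n,k\ge1$, $ASM^{\circ}_{n,k}$ (chained circular alternating sign matrices) is the set of $k$-tuples $(A^{(1)},\dots,A^{(k)})$ of $n\times n$ matrices with entries in $\{-1,0,1\}$ satisfying: (1) $\sum_{j=1}^m A^{(\ell)}_{i,j}\in\{0,1\}$ for all $1\le i\le n$, $1\le m\le n$, $1\le\ell\le k$; (2) $\sum_{j=1}^n A^{(\ell-1)}_{i,j}+\sum_{j=1}^m A^{(\ell)}_{n+1-j,i}\in\{0,1\}$ for all $1\le i\le n$, $1\le m\le n$, $1\le\ell\le k$, where $A^{(0)}=A^{(k)}$; (3) the sum of all entries $\sum_{i,j,\ell}A^{(\ell)}_{i,j}$ is maximum among all such $k$-tuples satisfying (1) and (2). *)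

(* Defs.v *)
From mathcomp Require Import all_boot all_order all_algebra.
From mathcomp Require Import boolp classical_sets functions.

Set Implicit Arguments.
Unset Strict Implicit.
Unset Printing Implicit Defensive.

Import Order.TTheory GRing.Theory Num.Theory.
Local Open Scope ring_scope.

Definition sign_entries (n : nat) (A : 'M[int]_n) : Prop :=
  forall i j, A i j \in [:: -1; 0; 1].

Definition alternating (s : seq int) : bool :=
  sorted (fun x y : int => x * y < 0) [seq x <- s | x != 0].

Definition is_asm (n : nat) (A : 'M[int]_n) : Prop :=
  [/\ sign_entries A,
      forall i, \sum_j A i j = 1,
      forall j, \sum_i A i j = 1,
      forall i, alternating [seq A i j | j : 'I_n] &
      forall j, alternating [seq A i j | i : 'I_n]].

(* Rotation by 90 degrees; invariance does not depend on its direction. *)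
Definition rot90 (n : nat) (A : 'M[int]_n) : 'M[int]_n :=
  \matrix_(i, j) A j (rev_ord i).

Definition QTASM (n : nat) : set 'M[int]_n :=
  [set A | is_asm A /\ rot90 A = A]%classic.

(* Indices start at 0, so the partial sum of the first m terms, 1 <= m <= n,
   is the sum over j <= m with m : 'I_n, and n + 1 - j becomes rev_ord j.
   The cyclic predecessor ord_pred encodes the convention A^(0) = A^(k). *)
Definition chained (n k : nat) (A : k.-tuple 'M[int]_n) : Prop :=
  [/\ forall l : 'I_k, sign_entries (tnth A l),
      forall (l : 'I_k) (i m : 'I_n),
        \sum_(j < n | (j <= m)%N) tnth A l i j \in [:: 0; 1] &
      forall (l : 'I_k) (i m : 'I_n),
        \sum_j tnth A (ord_pred l) i j
          + \sum_(j < n | (j <= m)%N) tnth A l (rev_ord j) i \in [:: 0; 1]].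

Definition entry_sum (n k : nat) (A : k.-tuple 'M[int]_n) : int :=
  \sum_l \sum_i \sum_j tnth A l i j.

Definition ASMcirc (n k : nat) : set (k.-tuple 'M[int]_n) :=
  [set A | chained A /\
     forall B : k.-tuple 'M[int]_n, chained B -> entry_sum B <= entry_sum A]%classic.

(* Main.v *)
Require Import Defs.
From mathcomp Require Import all_boot all_order all_algebra.
From mathcomp Require Import boolp classical_sets functions.
From mathcomp Require Import zify.

Set Implicit Arguments.
Unset Strict Implicit.
Unset Printing Implicit Defensive.

Import Order.TTheory GRing.Theory Num.Theory.

(** The bijection sends a matrix A to the matrix of size 2n whose upper left
    quadrant is A and whose other quadrants are the quarter turns of A.

    In such a matrix, row i of the upper half is row i of A followed by column
    i of A read from bottom to top ([unfold_row]).  The inequalities (1) and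
    (2) for k = 1 say that the partial sums along exactly this sequence stay in
    {0, 1} ([chained1P]).  On the other side, a sequence of signs with sum 1
    alternates if and only if its partial sums stay in {0, 1} ([asm_lineE]).
    By symmetry, every row and column of a quarter-turn symmetric matrix is a
    row of the upper half, possibly reversed, so such a matrix is alternating
    sign as soon as these n rows have partial sums in {0, 1} and total 1
    ([unfold_asmP]).

    It remains to match the totals with the maximality condition (3).  The n
    totals add up to twice the entry sum of A, because each entry lies on one
    row and one column ([sum_half_lines]).  Each total is at most 1, so
    the entry sum is at most n/2, and it equals n/2 precisely when all totals
    are 1 ([entry_sum_eqP]).  For even n the value n/2 is attained: pair the
    indices 2t and 2t+1 and put a 1 at each position (2t, 2t+1)
    ([pairing_line]).  Hence maximality means that all totals are 1
    ([ASMcirc1P]). *)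

Section QuarterTurn.
Local Open Scope ring_scope.

Notation signs := [:: -1; 0; 1 : int].
Notation bits := [:: 0; 1 : int].

(** * Alternation and partial sums *)

(** The starting height h makes the property compatible with concatenation:
    the second piece starts at the height where the first one ends. *)
Definition steps_bounded (h : int) (s : seq int) : bool :=
  all (mem bits) (scanl +%R h s).

Definition asm_line (s : seq int) : bool :=
  [&& all (mem signs) s, \sum_(x <- s) x == 1 & alternating s].

Lemma steps_bounded_cat h s t :
  steps_bounded h (s ++ t) =
  steps_bounded h s && steps_bounded (h + \sum_(x <- s) x) t.
Proof.
elim: s h => [|x s IHs] h; first by rewrite big_nil addr0.
by rewrite /steps_bounded /= big_cons addrA -andbA; congr (_ && _); apply: IHs.
Qed.

Lemma steps_bounded_sum h s : h \in bits -> steps_bounded h s ->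
  h + \sum_(x <- s) x \in bits.
Proof.
elim: s h => [|x s IHs] h hb; first by rewrite big_nil addr0.
by rewrite /steps_bounded /= big_cons addrA => /andP[/IHs].
Qed.

(** At height 1 the next nonzero step has to be -1, at height 0 it has to be
    1; so the height records the last nonzero step, and [h *+ 2 - 1] is that
    step, with -1 as a fictitious predecessor when h = 0. *)
Lemma steps_boundedE h s : h \in bits ->
  steps_bounded h s =
  all (mem signs) s &&
  path (fun x y : int => x * y < 0) (h *+ 2 - 1) [seq x <- s | x != 0].
Proof.
elim: s h => [|x s IHs] h // hb; rewrite /steps_bounded /=.
case: (boolP (x \in signs)) => xs; last first.
  apply/andP => -[hx _]; case/negP: xs; move: hb hx; rewrite !inE; lia.
rewrite -/(steps_bounded _ _).
by move: hb xs; rewrite !inE => /orP[]/eqP-> /or3P[]/eqP->;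
  rewrite /= ?IHs //= ?andbF.
Qed.

(** Without negative steps the heights increase towards the final value 1. *)
Lemma nonneg_steps_bounded (h : int) (s : seq int) :
  h \in bits -> (forall x, x \in s -> 0 <= x) ->
  h + \sum_(x <- s) x = 1 -> steps_bounded h s.
Proof.
elim: s h => [|x s IHs] h // hb s_ge0; rewrite /steps_bounded /=.
have x_ge0 : 0 <= x by apply: s_ge0; rewrite mem_head.
have tail_ge0 y : y \in s -> 0 <= y.
  by move=> ys; apply: s_ge0; rewrite inE ys orbT.
rewrite big_cons addrA => sum1.
have bitsD (a b c : int) :
    a \in bits -> 0 <= b -> 0 <= c -> a + b + c = 1 -> a + b \in bits.
  by rewrite !inE; lia.
have hx : h + x \in bits.
  by apply: bitsD hb x_ge0 _ sum1; rewrite big_seq sumr_ge0.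
by rewrite hx; apply: IHs.
Qed.

(** By [steps_boundedE], the two sides can only differ when the first nonzero
    entry of an alternating sequence is -1.  Then the sequence stays in {0, 1}
    when started at height 1, so its sum is nonpositive. *)
Lemma asm_lineE s :
  asm_line s = steps_bounded 0 s && (\sum_(x <- s) x == 1).
Proof.
rewrite /asm_line [RHS]andbC [LHS]andbCA; case: eqP => //= sum1.
rewrite steps_boundedE // /alternating.
case: (boolP (all (mem signs) s)) => //= signs_s.
(* Started at height 1, the sequence would end at height 2. *)
have := steps_boundedE s (isT : 1 \in bits); rewrite signs_s /=.
have := @steps_bounded_sum 1 s isT; rewrite sum1.
case: (steps_bounded 1 s) => [/(_ isT)//|_].
have: all (mem signs) [seq x <- s | x != 0].
  by apply/allP => x; rewrite mem_filter => /andP[_ /(allP signs_s)].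
have: all (fun x => x != 0) [seq x <- s | x != 0] by apply: filter_all.
case: [seq x <- s | x != 0] => [|y t] //= /andP[y0 _] /andP[ys _].
by move: ys y0; rewrite !inE => /or3P[]/eqP->.
Qed.

Lemma asm_line_rev s : asm_line (rev s) = asm_line s.
Proof.
rewrite /asm_line all_rev (perm_big s) ?perm_rev //=; congr [&& _, _ & _].
rewrite /alternating filter_rev rev_sorted.
by apply: eq_sorted => x y; rewrite mulrC.
Qed.

(** * Lines of a matrix as sequences *)

Lemma size_codom_ord n (F : 'I_n -> int) : size [seq F j | j : 'I_n] = n.
Proof. by rewrite size_map size_enum_ord. Qed.

Lemma nth_codom_ord n (F : 'I_n -> int) (i : 'I_n) :
  nth 0 [seq F j | j : 'I_n] i = F i.
Proof.
by rewrite (nth_map i) ?size_enum_ord // nth_ord_enum.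
Qed.

Lemma codom_rev_ord n (F : 'I_n -> int) :
  [seq F (rev_ord j) | j : 'I_n] = rev [seq F j | j : 'I_n].
Proof.
apply: (@eq_from_nth _ 0) => [|i]; rewrite ?size_rev !size_codom_ord // => lt_in.
rewrite nth_rev ?size_codom_ord //.
by rewrite (nth_codom_ord _ (Ordinal lt_in)) -(nth_codom_ord F).
Qed.

Lemma sum_codom n (F : 'I_n -> int) :
  \sum_(x <- [seq F j | j : 'I_n]) x = \sum_j F j.
Proof. by rewrite big_map big_enum. Qed.

Lemma steps_boundedP n h (F : 'I_n -> int) :
  reflect (forall m : 'I_n, h + \sum_(j < n | (j <= m)%N) F j \in bits)
    (steps_bounded h [seq F j | j : 'I_n]).
Proof.
apply: (iffP idP).
  elim: n h F => [|n IHn] h F; first by move=> _ [].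
  rewrite /steps_bounded /image_mem enum_ordSl /= -map_comp.
  move=> /andP[h0 /IHn H] m; rewrite big_mkcond big_ord_recl /= addrA.
  case: (unliftP ord0 m) => [m'|] ->; last by rewrite big1 ?addr0.
  by have := H m'; rewrite big_mkcond.
elim: n h F => [|n IHn] h F H.
  by rewrite /steps_bounded /image_mem enum_ord0.
rewrite /steps_bounded /image_mem enum_ordSl /= -map_comp.
apply/andP; split.
  have := H ord0; rewrite big_mkcond big_ord_recl /= big1 ?addr0 //.
apply: IHn => m; have := H (lift ord0 m).
by rewrite big_mkcond big_ord_recl /= addrA -big_mkcond.
Qed.

Lemma is_asmE n (M : 'M[int]_n) :
  is_asm M <->
  (forall i, asm_line [seq M i j | j : 'I_n]) /\
  (forall j, asm_line [seq M i j | i : 'I_n]).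
Proof.
split=> [[sM rM cM aM bM]|[rM cM]].
  split=> i; rewrite /asm_line sum_codom ?rM ?cM ?aM ?bM eqxx !andbT;
  by apply/allP => x /mapP[j _ ->]; apply: sM.
split.
- move=> i j; have /and3P[/allP sM _ _] := rM i.
  by apply: sM; apply: codom_f.
- by move=> i; have /and3P[_] := rM i; rewrite sum_codom => /eqP.
- by move=> i; have /and3P[_] := cM i; rewrite sum_codom => /eqP.
- by move=> i; have /and3P[] := rM i.
- by move=> i; have /and3P[] := cM i.
Qed.

(** * Unfolding a matrix under quarter turns *)

Section Fold.
Variable n : nat.
Implicit Types (A : 'M[int]_n) (M : 'M[int]_(2 * n)).

Lemma le_n_2n : (n <= 2 * n)%N. Proof. lia. Qed.

Lemma fold_subproof (i : 'I_(2 * n)) : (minn i (rev_ord i) < n)%N.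
Proof. by case: i => i /= lt_i; lia. Qed.

(** Reflects the second half of the indices onto the first half. *)
Definition fold_ord (i : 'I_(2 * n)) : 'I_n := Ordinal (fold_subproof i).

(** A half turn maps (i, j) to its two reflected indices, while a quarter turn
    also swaps them; so the indices are swapped exactly in the upper right and
    lower left quadrants. *)
Definition unfold A : 'M[int]_(2 * n) :=
  \matrix_(i, j) if (i < n)%N == (j < n)%N then A (fold_ord i) (fold_ord j)
                 else A (fold_ord j) (fold_ord i).

Definition quadrant M : 'M[int]_n :=
  \matrix_(i, j) M (widen_ord le_n_2n i) (widen_ord le_n_2n j).

(** Column i is read from bottom to top because a clockwise quarter turn makes
    it the row that continues row i to the right. *)
Definition half_line A (i : 'I_n) : seq int :=
  [seq A i j | j : 'I_n] ++ [seq A (rev_ord j) i | j : 'I_n].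

Lemma fold_rev i : fold_ord (rev_ord i) = fold_ord i.
Proof. by apply: val_inj; case: i => i lt_i /=; lia. Qed.

Lemma rev_lt (i : 'I_(2 * n)) : (rev_ord i < n)%N = ~~ (i < n)%N.
Proof. by case: i => i lt_i /=; lia. Qed.

Lemma fold_widen i : fold_ord (widen_ord le_n_2n i) = i.
Proof. by apply: val_inj; case: i => i lt_i /=; lia. Qed.

Lemma widen_fold (i : 'I_(2 * n)) : (i < n)%N ->
  widen_ord le_n_2n (fold_ord i) = i.
Proof. by move=> lt_i; apply: val_inj; case: i lt_i => i /= ? ?; lia. Qed.

Lemma rot90_unfold A : rot90 (unfold A) = unfold A.
Proof.
apply/matrixP => i j; rewrite !mxE rev_lt !fold_rev.
by case: (ltnP i n); case: (ltnP j n).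
Qed.

Lemma unfoldK : cancel unfold quadrant.
Proof.
by move=> A; apply/matrixP => i j; rewrite !mxE /= !ltn_ord eqxx !fold_widen.
Qed.

Lemma rot90_entry m (M : 'M[int]_m) (i j : 'I_m) :
  rot90 M = M -> M i j = M j (rev_ord i).
Proof. by move=> {1}<-; rewrite mxE. Qed.

Lemma quadrantK M : rot90 M = M -> unfold (quadrant M) = M.
Proof.
move=> symM; apply/matrixP => i j; rewrite !mxE.
have widen_rev (k : 'I_(2 * n)) : ~~ (k < n)%N ->
    widen_ord le_n_2n (fold_ord k) = rev_ord k.
  by rewrite -rev_lt -fold_rev; apply: widen_fold.
case: (boolP (i < n)%N) => lti; case: (boolP (j < n)%N) => ltj /=;
  rewrite ?(widen_fold lti) ?(widen_fold ltj) ?(widen_rev _ lti)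
    ?(widen_rev _ ltj) //.
- by rewrite (rot90_entry _ _ symM) rev_ordK.
- by rewrite [RHS](rot90_entry _ _ symM).
by rewrite [RHS](rot90_entry _ _ symM) [RHS](rot90_entry _ _ symM).
Qed.

Lemma unfold_row A i :
  [seq unfold A (widen_ord le_n_2n i) j | j : 'I_(2 * n)] = half_line A i.
Proof.
apply: (@eq_from_nth _ 0) => [|k]; rewrite ?size_cat !size_codom_ord.
  by lia.
move=> ltk; rewrite nth_cat size_codom_ord (nth_codom_ord _ (Ordinal ltk)) !mxE /=.
rewrite ltn_ord fold_widen eq_sym eqb_id; case: (ltnP k n) => [ltkn|lenk].
  rewrite (nth_codom_ord _ (Ordinal ltkn)); congr (A _ _).
  by apply: val_inj => /=; lia.
have lt_kn : (k - n < n)%N by lia.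
rewrite (nth_codom_ord _ (Ordinal lt_kn)); congr (A _ _).
by apply: val_inj => /=; lia.
Qed.

(** The rows of the lower half are reversed rows of the upper half by the half
    turn, and the columns are reversed rows by the quarter turn. *)
Lemma unfold_asmP A :
  is_asm (unfold A) <-> forall i, asm_line (half_line A i).
Proof.
set M := unfold A; have symM : rot90 M = M := rot90_unfold A.
rewrite is_asmE; split=> [[rM _] i|H]; first by rewrite -unfold_row.
have rM i : asm_line [seq M i j | j : 'I_(2 * n)].
  case: (boolP (i < n)%N) => lti.
    by rewrite -(widen_fold lti) unfold_row.
  rewrite -rev_lt in lti.
  rewrite -asm_line_rev -codom_rev_ord.
  rewrite (_ : [seq _ | j : _] = [seq M (rev_ord i) j | j : 'I_(2 * n)]).
    by rewrite -(widen_fold lti) unfold_row.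
  apply: eq_codom => j.
  by rewrite [RHS](rot90_entry _ _ symM) [RHS](rot90_entry _ _ symM) rev_ordK.
split=> // j; rewrite (_ : [seq _ | i : _] = [seq M j (rev_ord i) | i : 'I_(2 * n)]).
  by rewrite codom_rev_ord asm_line_rev.
by apply: eq_codom => i; apply: rot90_entry.
Qed.

(** * Maximal chained matrices *)

(** For k = 1 the predecessor of the only index is that index itself, so
    condition (2) starts from the height reached by condition (1). *)
Lemma chained1P (t : 1.-tuple 'M[int]_n) :
  chained t <-> forall i, steps_bounded 0 (half_line (tnth t ord0) i).
Proof.
set A := tnth t ord0; split=> [[_ H1 H2] i|H].
  rewrite steps_bounded_cat add0r sum_codom; apply/andP; split.
    by apply/steps_boundedP => m; rewrite add0r; apply: H1.
  apply/steps_boundedP => m; have := H2 ord0 i m.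
  by rewrite (ord1 (ord_pred _)).
have H' i : steps_bounded 0 [seq A i j | j : 'I_n] /\
    steps_bounded (\sum_j A i j) [seq A (rev_ord j) i | j : 'I_n].
  by have := H i; rewrite steps_bounded_cat add0r sum_codom => /andP.
split=> l; rewrite (ord1 l).
- move=> i j; have [] := H' i; rewrite steps_boundedE // => /andP[/allP sA _] _.
  by apply: sA; apply: codom_f.
- by move=> i m; have [/steps_boundedP/(_ m)] := H' i; rewrite add0r.
by move=> i m; have [_ /steps_boundedP/(_ m)] := H' i; rewrite (ord1 (ord_pred _)).
Qed.

(** Each entry (i, j) is counted on half lines i and j. *)
Lemma sum_half_lines (t : 1.-tuple 'M[int]_n) :
  \sum_i \sum_(x <- half_line (tnth t ord0) i) x = entry_sum t *+ 2.
Proof.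
rewrite /entry_sum big_ord1 mulr2n; under eq_bigr do
  rewrite big_cat !sum_codom.
rewrite big_split; congr (_ + _); rewrite exchange_big /=.
by rewrite [RHS](reindex_inj rev_ord_inj).
Qed.

Lemma half_line_sum_le1 (t : 1.-tuple 'M[int]_n) i : chained t ->
  \sum_(x <- half_line (tnth t ord0) i) x <= 1.
Proof.
move=> /chained1P/(_ i)/(@steps_bounded_sum 0)-/(_ isT).
by rewrite add0r !inE => /orP[]/eqP->.
Qed.

Lemma entry_sum_le (t : 1.-tuple 'M[int]_n) : chained t ->
  entry_sum t *+ 2 <= n%:R.
Proof.
move=> ct; rewrite -sum_half_lines -[n in n%:R]card_ord -sumr_const.
by apply: ler_sum => i _; apply: half_line_sum_le1.
Qed.

(** The defect n - 2 * entry_sum is a sum of nonnegative terms, one for each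
    half line, and vanishes only if all of them do. *)
Lemma entry_sum_eqP (t : 1.-tuple 'M[int]_n) : chained t ->
  entry_sum t *+ 2 = n%:R <->
  forall i, \sum_(x <- half_line (tnth t ord0) i) x = 1.
Proof.
move=> ct; rewrite -sum_half_lines -[n in n%:R]card_ord -sumr_const.
split=> [|H]; last exact: eq_bigr.
move=> /esym/eqP; rewrite -subr_eq0 -sumrB psumr_eq0 => [/allP H i|i _].
  by apply/esym/eqP; rewrite -subr_eq0; apply: H; rewrite mem_index_enum.
by rewrite subr_ge0 half_line_sum_le1.
Qed.

(** Entry 1 at the positions (2t, 2t+1): every half line then meets a single
    nonzero entry. *)
Definition pairing_mx : 'M[int]_n :=
  \matrix_(i, j) (~~ odd i && (j == i.+1 :> nat))%:R.

(** This is where the parity of n enters: the index n - 1 needs to be odd in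
    order to be paired with n - 2. *)
Lemma pairing_line i : ~~ odd n ->
  asm_line (half_line pairing_mx i).
Proof.
move=> n_even; rewrite asm_lineE.
have sum1 : \sum_(x <- half_line pairing_mx i) x = 1.
  rewrite big_cat /= !sum_codom.
  case: (boolP (odd i)) => i_odd.
    (* For odd i the 1 lies in column i, at row i - 1. *)
    have lt_i : (i.-1 < n)%N by have := ltn_ord i; lia.
    rewrite big1 ?add0r => [|j _]; last by rewrite mxE i_odd.
    rewrite (reindex_inj rev_ord_inj) (bigD1 (Ordinal lt_i)) //= rev_ordK mxE.
    rewrite big1 /= => [|j]; last first.
      rewrite rev_ordK mxE -val_eqE /= => ne_j.
      by have -> : ~~ odd j && (i == j.+1 :> nat) = false by lia.
    have -> : ~~ odd i.-1 && (i == i.-1.+1 :> nat) by lia.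
    by rewrite addr0.
  (* For even i the 1 lies in row i, at column i + 1 < n as n is even. *)
  have lt_i : (i.+1 < n)%N by have := ltn_ord i; lia.
  rewrite [X in _ + X]big1 ?addr0 => [|j _]; last first.
    rewrite mxE; set k := rev_ord j.
    by have -> : ~~ odd k && (i == k.+1 :> nat) = false by lia.
  rewrite (bigD1 (Ordinal lt_i)) //= mxE i_odd eqxx big1 ?addr0 // => j.
  by rewrite mxE -val_eqE /= => /negPf->; rewrite andbF.
rewrite sum1 eqxx andbT; apply: nonneg_steps_bounded; rewrite ?add0r //.
by move=> x; rewrite mem_cat => /orP[]/mapP[j _ ->]; rewrite mxE ler0n.
Qed.

Lemma ASMcirc1P (t : 1.-tuple 'M[int]_n) : ~~ odd n ->
  ASMcirc t <-> forall i, asm_line (half_line (tnth t ord0) i).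
Proof.
move=> n_even.
have lineP (u : 1.-tuple 'M[int]_n) :
    (forall i, asm_line (half_line (tnth u ord0) i)) <->
    chained u /\ entry_sum u *+ 2 = n%:R.
  split=> [H|[cu]].
    have cu : chained u.
      by apply/chained1P => i; have := H i; rewrite asm_lineE => /andP[].
    split=> //; apply/entry_sum_eqP => // i.
    by have := H i; rewrite asm_lineE => /andP[_ /eqP].
  move/(entry_sum_eqP cu) => sum1 i; rewrite asm_lineE sum1 eqxx andbT.
  by move/chained1P: cu; apply.
(* Maximality forces the value n / 2 only because some matrix attains it. *)
have [cp sp] : chained [tuple pairing_mx] /\
    entry_sum [tuple pairing_mx] *+ 2 = n%:R.
  by apply/lineP => i; apply: pairing_line.
rewrite lineP; split=> [[ct maxt]|[ct st]]; split=> //.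
  by have := maxt _ cp; have := entry_sum_le ct; lia.
by move=> u /entry_sum_le; lia.
Qed.

End Fold.
End QuarterTurn.

Theorem proposition4p13 (n : nat) (hn : (2 <= n)%N) (n_even : ~~ odd n) :
  exists f : 1.-tuple 'M[int]_n -> 'M[int]_(2 * n),
    set_bij (@ASMcirc n 1) (@QTASM (2 * n)) f.
Proof.
exists (fun t => unfold (tnth t ord0)); split.
- move=> t /(ASMcirc1P _ n_even)/unfold_asmP asm_t.
  by split=> //; apply: rot90_unfold.
- move=> t u _ _ /(can_inj (@unfoldK n)) eq_tu.
  by apply: eq_from_tnth => l; rewrite (ord1 l).
move=> M [asmM /quadrantK unfoldM]; exists [tuple quadrant M] => //=.
by apply/(ASMcirc1P _ n_even)/unfold_asmP; rewrite unfoldM.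
Qed.
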